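(* Let $d=1$, $S=\{-1,1\}$, and let $\mu$ be the product measure on $\Omega=\{-1,1\}^{\mathbb{Z}}$ under which each coordinate equals $+1$ or $-1$ with probability $1/2$. Then there exists a sequence of local functions $(g_L)_{L\ge1}$ on $\Omega$ such that $$\sup_L\mathrm{Lip}_2(g_L)<\infty\qquad\text{but}\qquad\liminf_{L\to\infty}\log\int e^{g_L-\mu(g_L)}\,d\mu=\infty.$$
   Context: A function $f:\Omega\to\mathbb{R}$ is local if it depends only on finitely many coordinates; $\mathrm{dep}(f)$ denotes the smallest (finite) set of sites on which it depends. $\mu(f)=\int f\,d\mu$. For finite $\Lambda\subset\mathbb{Z}$ and configurations $\sigma,\eta$, $d_{2,\Lambda}(\sigma,\eta)=\big(\sum_{i\in\Lambda}\mathbf 1_{\{\sigma_i\neq\eta_i\}}\big)^{1/2}$. For a local function $f$, $$\mathrm{Lip}_2(f)=\sup\frac{f(\sigma)-f(\eta)}{d_{2,\mathrm{dep}(f)}(\sigma,\eta)},$$ the supremum being over pairs $\sigma,\eta$ whose restrictions to $\mathrm{dep}(f)$ are distinct. *)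

(* Defs.v *)
From HB Require Import structures.
From mathcomp Require Import all_boot all_order all_algebra finmap.
From mathcomp Require Import all_classical all_reals all_analysis.

Set Implicit Arguments.
Unset Strict Implicit.
Unset Printing Implicit Defensive.
Import Order.TTheory GRing.Theory Num.Theory.
Import numFieldNormedType.Exports.
Local Open Scope classical_set_scope.
Local Open Scope ring_scope.

Definition spin : Type := seq_sub [:: -1; 1 : int].

HB.instance Definition _ := Finite.copy spin (seq_sub [:: -1; 1 : int]).

Definition spin_minus : spin := SeqSub (isT : -1 \in [:: -1; 1 : int]).
Definition spin_plus : spin := SeqSub (isT : 1 \in [:: -1; 1 : int]).

HB.instance Definition _ := isPointed.Build spin spin_plus.
HB.instance Definition _ := @isMeasurable.Build default_measure_display
  spin discrete_measurable discrete_measurable0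
  discrete_measurableC discrete_measurableU.

(* [Omega] carries the product sigma-algebra, i.e. the one generated by the
   coordinate maps. *)
Definition coordinate_sets : set (set (int -> spin)) :=
  \bigcup_(i : int)
    preimage_set_system setT (fun s : int -> spin => s i) measurable.

Definition Omega : Type := g_sigma_algebraType coordinate_sets.

HB.instance Definition _ := Pointed.on Omega.
HB.instance Definition _ := Measurable.on Omega.

Section product_measure.
Context {R : realType}.
Local Open Scope ereal_scope.

Definition fair_spin (A : set spin) : \bar R :=
  (2^-1)%:E * (\d_spin_minus A + \d_spin_plus A).

(* A probability on [Omega] is determined by its values on finite-dimensional
   rectangles, so at most one [mu] satisfies this. *)
Definition is_product_measure (nu : set spin -> \bar R)
    (mu : probability Omega R) : Prop :=
  forall (L : {fset int}) (B : int -> set spin),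
    mu [set s : Omega | forall i, i \in L -> B i (s i)] =
    \prod_(i <- L) nu (B i).

End product_measure.

Section local_functions.
Context {R : realType}.
Implicit Types (f : Omega -> R) (L : set int) (s e : Omega).

Definition depends_only_on f L :=
  forall s e, (forall i, L i -> s i = e i) -> f s = f e.

Definition is_local f := exists2 L, finite_set L & depends_only_on f L.

(* Intersection of all finite sets on which [f] depends; [dep_smallest] below
   shows that for local [f] it is itself such a set. *)
Definition dep f : set int :=
  smallest [set L | finite_set L /\ depends_only_on f L] set0.

Definition d2 L s e : R := Num.sqrt (\sum_(i \in L) ((s i != e i)%:R : R)).

(* For constant [f] the supremum is over the empty set and equals [-oo]. *)
Definition Lip2 f : \bar R :=
  ereal_sup [set r : \bar R | exists s e : Omega,
    (exists2 i, dep f i & s i <> e i) /\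
    r = ((f s - f e) / d2 (dep f) s e)%:E].

Lemma depends_only_onI f L1 L2 : depends_only_on f L1 ->
  depends_only_on f L2 -> depends_only_on f (L1 `&` L2).
Proof.
move=> f1 f2 s e se.
pose t : Omega := fun i : int => if i \in L1 then s i else e i.
rewrite (f1 s t) => [|i L1i]; last by rewrite /t mem_set.
apply: f2 => i L2i; rewrite /t; case: ifPn => // /set_mem L1i; exact: se.
Qed.

Lemma dep_smallest f : is_local f ->
  [/\ finite_set (dep f), depends_only_on f (dep f) &
      forall L, finite_set L -> depends_only_on f L -> dep f `<=` L].
Proof.
move=> [L0 finL0 fL0].
have sub L : finite_set L -> depends_only_on f L -> dep f `<=` L.
  by move=> finL fL; apply: smallest_sub => //; split.
have finD : finite_set (dep f) by exact: sub_finite_set (sub _ finL0 fL0) finL0.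
split=> //.
have H n : forall L, finite_set L -> depends_only_on f L ->
    (#|` fset_set L| <= n)%N -> depends_only_on f (dep f).
  elim: n => [|n IH] L finL fL.
    rewrite leqn0 cardfs_eq0 => /eqP L0'.
    have LE : L = set0 by rewrite -(fset_setK finL) L0' set_fset0.
    have := sub _ finL fL; rewrite LE subset0 => ->; by rewrite -LE.
  move=> leL.
  have [Ld|/existsNP[i /not_implyP[Li nDi]]] := pselect (L `<=` dep f).
    by have -> : dep f = L by apply/seteqP; split=> //; exact: sub.
  have [M [[finM fM] _] nMi] : exists2 M,
      [set M | [set L | finite_set L /\ depends_only_on f L] M /\
               set0 `<=` M] M & ~ M i.
    by apply: contra_notP nDi => nex M HM; apply: contra_notP nex => nMi; exists M.
  apply: (IH (L `&` M)).
  - exact: finite_setIl.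
  - exact: depends_only_onI.
  rewrite -ltnS (leq_trans _ leL)//; apply: fproper_ltn_card.
  rewrite fset_setI// fproperE; apply/andP; split.
    by apply/fsubsetP => j; rewrite inE => /andP[].
  apply/negP => /fsubsetP /(_ i); rewrite inE !in_fset_set// mem_set//.
  by rewrite memNset// andbF => /(_ isT).
exact: (H _ _ finL0 fL0 (leqnn _)).
Qed.

End local_functions.

(* Main.v *)
Require Import Defs.
From mathcomp Require Import all_boot all_order all_algebra.
From mathcomp Require Import all_classical all_reals all_analysis.
From mathcomp Require Import finmap ring lra.
Import Order.TTheory GRing.Theory Num.Theory.
Import numFieldNormedType.Exports.
Local Open Scope classical_set_scope.
Local Open Scope ring_scope.

(** Let [S] be the sum of the spins over a finite set of [L] sites, and let
    [g = sgn(S) * sqrt |S|]. Changing [H] spins changes [S] by at most [2 * H],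
    and the signed square root satisfies [|ssqrt x - ssqrt y| <= sqrt (2 * |x - y|)],
    so [Lip2 g <= 2]. By the symmetry [s -> -s] the mean of [g] is [0] and
    [E e^g = E (e^g + e^-g) / 2 >= E g^4 / 48 = E S^2 / 48 = L / 48]. *)

(** * The signed square root, and an exponential inequality *)

Definition ssqrt (R : rcfType) (x : R) : R := Num.sg x * Num.sqrt `|x|.

Lemma ssqrtN (R : rcfType) (x : R) : ssqrt R (- x) = - ssqrt R x.
Proof. by rewrite /ssqrt sgrN normrN mulNr. Qed.

Lemma ssqrt_expr4 (R : rcfType) (x : R) : ssqrt R x ^+ 4 = x ^+ 2.
Proof.
rewrite /ssqrt exprMn (exprM _ 2 2) (exprM (Num.sqrt _) 2 2) sqr_sqrtr//.
rewrite sqr_sg real_normK ?num_real//.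
by have [->|x0] := eqVneq x 0; rewrite ?expr0n ?mulr0//= expr1n mul1r.
Qed.

(** The inverse map [u * |u|] turns root estimates into polynomial ones. *)
Lemma ssqrt_mul_norm (R : rcfType) (x : R) : ssqrt R x * `|ssqrt R x| = x.
Proof.
rewrite /ssqrt normrM (ger0_norm (sqrtr_ge0 _)) mulrACA -expr2 sqr_sqrtr//.
rewrite normr_sg; have [->|x0] := eqVneq x 0; first by rewrite normr0 mulr0.
by rewrite mulr1 -numEsg.
Qed.

Lemma ssqrt_sub_le (R : rcfType) (x y : R) :
  ssqrt R x - ssqrt R y <= Num.sqrt (2 * `|x - y|).
Proof.
rewrite -{2}(ssqrt_mul_norm R x) -{2}(ssqrt_mul_norm R y).
move: (ssqrt R x) (ssqrt R y) => {x y} u v.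
apply: (le_trans (ler_norm _)); rewrite -(sqrtr_sqr (u - v)); apply: ler_wsqrtr.
(* Of the norm [w] of [D = u * |u| - v * |v|] only [-w <= D <= w] is kept. For opposite signs,
   [2 * |D| - (u - v)^2] is exactly [(u + v)^2], hence the square supplied to [nra]. *)
have := lexx `|u * `|u| - v * `|v| |; rewrite {1}ler_norml => /andP[].
move: (`|u * `|u| - v * `|v| |) (sqr_ge0 (u + v)) => w.
by case: (ger0P u); case: (ger0P v); case: (leP u v) => *; nra.
Qed.

(** The left side is even, so take [0 <= x]; then [expR x] alone dominates its Taylor term of order
    4. *)
Lemma expR_cosh_ge (R : realType) (x : R) :
  x ^+ 4 / 24 <= expR x + expR (- x).
Proof.
wlog x0 : x / 0 <= x => [H|].
  have [/H//|x0] := leP 0 x.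
  rewrite addrC (_ : x ^+ 4 = (- x) ^+ 4); last by ring.
  by rewrite -{3}(opprK x) H// oppr_ge0 ltW.
have := expR_ge1Dxn 3 x0; have := expR_ge0 (- x).
rewrite (_ : (3.+1)`! = 24)//; lra.
Qed.

(** * Bounding the Lipschitz constant *)

(** Bounds [Lip2 f] without computing [dep f]: pairs that agree off [dep f] have the same distance
    on [dep f] as on the larger set [A]. *)
Lemma Lip2_le (R : realType) (f : Omega -> R) (A : set int) (C : R) :
  finite_set A -> depends_only_on f A -> 0 <= C ->
  (forall s e, f s - f e <= C * d2 A s e) -> (Lip2 f <= C%:E)%E.
Proof.
move=> finA fA C0 H; apply: ge_ereal_sup => _ [s [e [[i fi sei] ->]]].
have [_ fdep sub] := dep_smallest (ex_intro2 _ _ A finA fA).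
have dA := sub _ finA fA.
(* off [dep f], [e] may be replaced by [s] without changing [f e] *)
pose e' : Omega := fun j => if j \in dep f then e j else s j.
have -> : f e = f e'.
  by apply: fdep => j fj; rewrite /e' mem_set.
have -> : d2 (dep f) s e = d2 A s e' :> R.
  rewrite /d2; congr Num.sqrt.
  rewrite (eq_fsbigr (fun j => (s j != e' j)%:R)); last by move=> j jf; rewrite /e' jf.
  apply: fsbig_widen => // j [_ /= njf].
  by rewrite /e' memNset// eqxx.
have := H s e'; rewrite lee_fin.
have : 0 <= d2 A s e' :> R by exact: sqrtr_ge0.
(* At distance 0 the convention that 0 has inverse 0 makes the quotient 0, and [0 <= C] applies. *)
rewrite le0r => /orP[/eqP->|d0 ?]; first by rewrite invr0 !mulr0.
by rewrite ler_pdivrMr.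
Qed.

(** * Spins and sums over finite spin configurations *)

Definition spin_val (R : realType) (a : spin) : R := (val a)%:~R.

Definition spin_neg (a : spin) : spin :=
  if a == spin_plus then spin_minus else spin_plus.

Lemma spinP (a : spin) : a = spin_plus \/ a = spin_minus.
Proof.
by have := valP a; rewrite !inE => /orP[] /eqP aE; [right|left]; exact: val_inj.
Qed.

Lemma spin_negK : involutive spin_neg.
Proof. by move=> a; case: (spinP a) => ->. Qed.

Lemma spin_val_neg (R : realType) a : spin_val R (spin_neg a) = - spin_val R a.
Proof. by case: (spinP a) => ->; rewrite /spin_val /= ?mulrN1z ?opprK. Qed.

Lemma spin_val_sqr (R : realType) a : spin_val R a ^+ 2 = 1.
Proof. by case: (spinP a) => ->; rewrite /spin_val /= ?mulrN1z ?sqrrN ?expr1n. Qed.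

Lemma spin_val_dist (R : realType) a b :
  `|spin_val R a - spin_val R b| <= 2 * (a != b)%:R.
Proof.
have [->|] := eqVneq a b; first by rewrite subrr normr0 mulr0.
by case: (spinP a) => ->; case: (spinP b) => -> //= _;
  rewrite /spin_val /= ler_norml; apply/andP; split; lra.
Qed.

Lemma card_spin : #|{: spin}| = 2.
Proof. exact: (@card_seq_sub int [:: -1; 1 : int] isT). Qed.

(** Unnormalized second moment: after expanding the square, each diagonal term contributes the
    number of configurations and the off-diagonal terms cancel. *)
Lemma sum_spin_sqr (R : realType) (I : finType) :
  \sum_(x : {ffun I -> spin}) (\sum_i spin_val R (x i)) ^+ 2 =
  #|I|%:R * 2 ^+ #|I|.
Proof.
under eq_bigr do rewrite expr2 big_distrlr /=.
rewrite exchange_big /= -sumr_const mulr_suml; apply: eq_bigr => i _.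
rewrite exchange_big (bigD1 i)//= [X in _ + X]big1 => [|j ji].
  under eq_bigr do rewrite -expr2 spin_val_sqr.
  by rewrite sumr_const card_ffun card_spin addr0 natrX mul1r.
(* flipping coordinate [i] changes the sign of the sum *)
pose flip (x : {ffun I -> spin}) :=
  [ffun k => if k == i then spin_neg (x k) else x k].
have flipK : involutive flip.
  by move=> x; apply/ffunP => k; rewrite !ffunE; case: ifP => ->; rewrite ?spin_negK.
set T := LHS; suff : T = - T by lra.
rewrite {1}/T (reindex_inj (inv_inj flipK)) -sumrN; apply: eq_bigr => x _.
by rewrite !ffunE eqxx (negbTE ji) spin_val_neg mulNr.
Qed.

(** The global spin flip permutes the configurations and negates the sum. *)
Lemma sum_spin_sym (R : realType) (I : finType) (F : R -> R) :
  \sum_(x : {ffun I -> spin}) F (\sum_i spin_val R (x i)) =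
  \sum_(x : {ffun I -> spin}) F (- \sum_i spin_val R (x i)).
Proof.
pose neg (x : {ffun I -> spin}) := [ffun k => spin_neg (x k)].
have negK : involutive neg.
  by move=> x; apply/ffunP => k; rewrite !ffunE spin_negK.
rewrite (reindex_inj (inv_inj negK)); apply: eq_bigr => x _; congr F.
by rewrite -sumrN; apply: eq_bigr => i _; rewrite ffunE spin_val_neg.
Qed.

(** * Integrals of functions of finitely many spins *)

Definition restrict (A : {fset int}) (s : Omega) : {ffun A -> spin} :=
  [ffun i => s (val i)].

Section integral_of_local_functions.
Variables (R : realType) (mu : probability Omega R).
Hypothesis hmu : is_product_measure fair_spin mu.
Variable A : {fset int}.

Let cylinder (x : {ffun A -> spin}) : set Omega :=
  restrict A @^-1` [set x].

Lemma measurable_coordinate (i : int) (B : set spin) :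
  measurable ([set s | B (s i)] : set Omega).
Proof.
apply: sub_sigma_algebra; exists i => //; exists B => //.
by rewrite setTI.
Qed.

(** Extends [x] to the family of sets over all of [int] that [is_product_measure] expects: the
    singleton of [x i] on [A], every spin elsewhere. *)
Let slice (x : {ffun A -> spin}) (i : int) : set spin :=
  [set a | forall j : A, val j = i -> a = x j].

Lemma cylinderE x :
  cylinder x = [set s : Omega | forall i, i \in A -> slice x i (s i)].
Proof.
apply/seteqP; split => s /=.
  by move=> <- i iA j <-; rewrite ffunE.
by move=> H; apply/ffunP => j; rewrite ffunE; apply: H => //; exact: valP.
Qed.

Lemma measurable_cylinder x : measurable (cylinder x).
Proof.
rewrite cylinderE.
apply: (@fin_bigcap_measurable _ Omega int [set` A]
  (fun i => [set s | slice x i (s i)])) => // i _.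
exact: measurable_coordinate.
Qed.

Lemma fair_spin1 (a : spin) : fair_spin [set a] = (2^-1)%:E :> \bar R.
Proof.
rewrite /fair_spin !diracE !in_set1.
by case: (spinP a) => ->; rewrite /= ?adde0 ?add0e mule1.
Qed.

Lemma mu_cylinder x : mu (cylinder x) = (2 ^- #|` A|)%:E.
Proof.
rewrite cylinderE hmu big_seq_fsetE/=.
under eq_bigr => i _.
  rewrite (_ : slice x _ = [set x i]); last first.
    apply/seteqP; split => a /=; first exact.
    by move=> -> j /val_inj ->.
  rewrite fair_spin1; over.
by rewrite prodEFin prodr_const -cardfE exprVn.
Qed.

(** The integrand is a finite combination of indicators of cylinders, all of the same mass, so the
    integral is a uniform average. *)
Lemma integral_restrict (F : {ffun A -> spin} -> R) :
  (\int[mu]_s (F (restrict A s))%:E = (2 ^- #|` A| * \sum_x F x)%:E)%E.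
Proof.
have FE s : ((F (restrict A s))%:E =
    \sum_x (F x)%:E * (\1_(cylinder x) s)%:E)%E.
  rewrite (bigD1 (restrict A s))//= big1 => [|x xs].
    by rewrite adde0 indicE mem_set// mule1.
  by rewrite indicE memNset ?mule0// => /= sx; rewrite sx eqxx in xs.
under eq_integral do rewrite FE.
have mI x : mu.-integrable setT (fun s => (\1_(cylinder x) s)%:E).
  by apply: integrable_indic; exact: measurable_cylinder.
rewrite integral_sum// => [|x]; last by apply: integrableZl => //; exact: mI.
transitivity (\sum_x (2 ^- #|` A| * F x)%:E)%E.
  apply: eq_bigr => x _; rewrite integralZl//.
  rewrite integral_indic//; last exact: measurable_cylinder.
  by rewrite setIT [X in (_ * X)%E](mu_cylinder x) -EFinM mulrC.
by rewrite sumEFin mulr_sumr.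
Qed.

End integral_of_local_functions.

(** * The signed square root of the magnetization *)

Definition magnetization (R : realType) (A : {fset int}) (s : Omega) : R :=
  \sum_(i <- A) spin_val R (s i).

Lemma magnetization_restrict (R : realType) A s :
  magnetization R A s = \sum_(i : A) spin_val R (restrict A s i).
Proof.
by rewrite /magnetization big_seq_fsetE; apply: eq_bigr => i _; rewrite ffunE.
Qed.

Lemma magnetization_dist (R : realType) A s e :
  `|magnetization R A s - magnetization R A e| <=
  2 * \sum_(i \in [set` A]) ((s i != e i)%:R : R).
Proof.
rewrite -fsbig_seq//= /magnetization -sumrB mulr_sumr.
apply: (le_trans (ler_norm_sum _ _ _)).
by apply: ler_sum => i _; exact: spin_val_dist.
Qed.

Definition sqrt_magnetization (R : realType) (A : {fset int}) (s : Omega) : R :=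
  ssqrt R (magnetization R A s).

Lemma sqrt_magnetization_depends (R : realType) A :
  depends_only_on (sqrt_magnetization R A) [set` A].
Proof.
move=> s e se; congr ssqrt; apply: eq_big_seq => i iA.
by rewrite se.
Qed.

Lemma Lip2_sqrt_magnetization (R : realType) A :
  (Lip2 (sqrt_magnetization R A) <= 2%:E)%E.
Proof.
apply: Lip2_le (@sqrt_magnetization_depends R A) _ _ => // s e.
apply: (le_trans (ssqrt_sub_le _ _ _)).
(* With [H] disagreements both sides compare under the root: [2 * (2 * H)] against the square
   [4 * H] of [2 * d2]. *)
rewrite -[leRHS]ger0_norm ?mulr_ge0 ?sqrtr_ge0// -(sqrtr_sqr (2 * _)).
apply: ler_wsqrtr; rewrite exprMn sqr_sqrtr ?fsumr_ge0//.
by have := magnetization_dist R A s e; lra.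
Qed.

Lemma expectation_sqrt_magnetization (R : realType) (mu : probability Omega R)
    (A : {fset int}) : is_product_measure fair_spin mu ->
  \int[mu]_s sqrt_magnetization R A s = 0.
Proof.
move=> hmu; rewrite /Rintegral /sqrt_magnetization.
under eq_integral do rewrite magnetization_restrict.
rewrite (integral_restrict R mu hmu A (fun x => ssqrt R (\sum_i spin_val R (x i))))/=.
set T := \sum_x _; suff -> : T = 0 by rewrite mulr0.
have : T = - T; last by lra.
rewrite {1}/T sum_spin_sym -sumrN; apply: eq_bigr => x _.
exact: ssqrtN.
Qed.

(** The real witness [v] records that the integral is finite, so that its extended logarithm reduces
    to [ln v]. *)
Lemma exp_moment_sqrt_magnetization (R : realType) (mu : probability Omega R)
    (A : {fset int}) : is_product_measure fair_spin mu ->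
  exists2 v : R, (\int[mu]_s (expR (sqrt_magnetization R A s))%:E)%E = v%:E &
    #|` A|%:R / 48 <= v.
Proof.
move=> hmu; rewrite /sqrt_magnetization.
under eq_integral do rewrite magnetization_restrict.
rewrite (integral_restrict R mu hmu A
  (fun x => expR (ssqrt R (\sum_i spin_val R (x i)))))/=.
eexists; first by [].
set T := \sum_x _.
(* Doubling [T] pairs each configuration with its flip; 48 is this 2 times the 24 of
   [expR_cosh_ge]. *)
suff H : #|` A|%:R * 2 ^+ #|` A| / 24 <= T + T.
  rewrite [leRHS]mulrC ler_pdivlMr ?exprn_gt0//; lra.
rewrite {2}/T (sum_spin_sym _ _ (fun y => expR (ssqrt R y))) -big_split/=.
rewrite cardfE -sum_spin_sqr mulr_suml; apply: ler_sum => x _.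
by rewrite ssqrtN -ssqrt_expr4; exact: expR_cosh_ge.
Qed.

Theorem propositionA2 (R : realType) (mu : probability Omega R)
    (hmu : is_product_measure fair_spin mu) :
  exists g : nat -> Omega -> R,
    [/\ forall L, (1 <= L)%N -> is_local (g L),
        (ereal_sup [set Lip2 (g L) | L in [set L | (1 <= L)%N]] < +oo)%E &
        limn_einf (fun L : nat =>
          lne (\int[mu]_s (expR (g L s - \int[mu]_t g L t))%:E)%E) = +oo%E].
Proof.
pose A (L : nat) : {fset int} := [fset i%:Z | i in iota 0 L]%fset.
have cardA L : #|` A L| = L.
  rewrite card_imfset /=; last by move=> i j [].
  by rewrite undup_id ?iota_uniq ?size_iota.
exists (fun L => sqrt_magnetization R (A L)); split.
- by move=> L _; exists [set` A L] => //; exact: sqrt_magnetization_depends.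
- apply: (@le_lt_trans _ _ 2%:E); last exact: ltry.
  by apply: ge_ereal_sup => _ [L _ <-]; exact: Lip2_sqrt_magnetization.
(* It is enough that the sequence itself tends to [+oo]: it exceeds [M] once [L >= 48 * expR M]. *)
- apply: (cvg_limn_einf_sup _).1; apply/cvgeyPge => M.
  near=> L.
  rewrite (expectation_sqrt_magnetization _ _ _ hmu).
  under eq_integral do rewrite subr0.
  have [v -> vL] := exp_moment_sqrt_magnetization _ _ (A L) hmu.
  rewrite cardA in vL.
  have Mv : expR M <= v.
    apply: le_trans vL; rewrite ler_pdivlMr//.
    by near: L; exact: nbhs_infty_ger.
  have v0 : 0 < v by apply: lt_le_trans Mv; exact: expR_gt0.
  by rewrite lne_EFin// lee_fin -(expRK M) ler_ln// posrE expR_gt0.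
Unshelve. all: by end_near.
Qed.
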